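(* Suppose that $R$ is an integral domain. Then $R$ is a discrete valuation ring (DVR) if and only if there is a non-unit, nonzero $\pi \in R$ such that every nonzero element of $R$ can be written as $u\pi^k$ for some unit $u \in R^\times$ and some $k \in \mathbb{N}$.
   Context: All rings are commutative with unity, and $\mathbb{N}=\{0,1,2,\dots\}$. A discrete valuation of a field $K$ is a surjective group homomorphism $v\colon K^\times \to \mathbb{Z}$ (from the multiplicative group of $K$ to the additive group $\mathbb{Z}$) such that $v(x+y)\ge \min\{v(x),v(y)\}$ for all $x,y\in K^\times$ with $x+y\neq 0$; by convention $v(0)=\infty$. A discrete valuation ring (DVR) is any ring of the form $\mathcal{O}_v=\{x\in K \mid v(x)\ge 0\}$, where $K$ is a field and $v$ is a discrete valuation of $K$. *)

(* Defs.v *)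
From HB Require Import structures.
From mathcomp Require Import all_boot all_order all_algebra.

Set Implicit Arguments.
Unset Strict Implicit.
Unset Printing Implicit Defensive.

Import Order.TTheory GRing.Theory Num.Theory.
Local Open Scope ring_scope.

(* A map v : K^* -> Z is represented by a total function K -> int whose value
   at 0 is irrelevant: no clause below, nor valuation_ring, depends on v 0. *)
Record discrete_valuation (K : fieldType) (v : K -> int) : Prop :=
  DiscreteValuation {
    dvalM : forall x y : K, x != 0 -> y != 0 -> v (x * y) = v x + v y;
    dval_surj : forall n : int, exists x : K, x != 0 /\ v x = n;
    dvalD : forall x y : K, x != 0 -> y != 0 -> x + y != 0 ->
      Num.min (v x) (v y) <= v (x + y)
  }.

(* The disjunct x == 0 encodes the convention v(0) = oo. *)
Definition valuation_ring (K : fieldType) (v : K -> int) : {pred K} :=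
  [pred x | (x == 0) || (0 <= v x)].

(* "Of the form O_v" is up to ring isomorphism: f is an isomorphism from R onto
   the subring O_v of K. *)
Definition is_DVR (R : comPzRingType) : Prop :=
  exists (K : fieldType) (v : K -> int) (f : {rmorphism R -> K}),
    [/\ discrete_valuation v,
        injective f
      & forall x : K, x \in valuation_ring v <-> exists r : R, f r = x].

(* Main.v *)
Require Import Defs.
From HB Require Import structures.
From mathcomp Require Import all_boot all_order all_algebra.

(** In the ring of a discrete valuation [v], an element [pi] of valuation [1],
    which exists because [v] is surjective, generates everything up to units.
    Indeed the units of the ring are exactly its elements of valuation [0]
    ([val_ring_unit]): an inverse in the field has the opposite valuation.  So
    [pi] is not a unit, and if [x] has valuation [k] then [x / pi ^ k] is a
    unit.

    Conversely, let every nonzero element of [R] be a unit times a power of a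
    non-unit [pi].  A quotient of two such elements is again a unit of [R] times
    an integer power of [pi] ([has_order_exists]), and the exponent is unique
    because no positive power of [pi] is a unit ([has_order_uniq]).  The
    exponent is therefore a function on the nonzero fractions, the pi-adic
    valuation.  Exponents add under products; in a sum the lower power of [pi]
    factors out and leaves an element of [R], whose order is nonnegative
    ([has_order_add]).  Finally a nonzero fraction lies in [R] exactly when its
    order is nonnegative ([has_order_integral]), which identifies [R] with the
    valuation ring inside its fraction field. *)

Set Implicit Arguments.
Unset Strict Implicit.
Unset Printing Implicit Defensive.

Import Order.TTheory GRing.Theory Num.Theory.
Local Open Scope ring_scope.

(** * Uniformizers of a valuation ring *)

Section ValuationRing.

Variables (R : idomainType) (K : fieldType) (v : K -> int).
Variable f : {rmorphism R -> K}.
Hypothesis vP : discrete_valuation v.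
Hypothesis f_inj : injective f.
Hypothesis f_im :
  forall x : K, x \in valuation_ring v <-> exists r : R, f r = x.

Lemma dval1 : v 1 = 0.
Proof.
by apply: (addrI (v 1)); rewrite -(dvalM vP) ?oner_neq0 // mulr1 addr0.
Qed.

Lemma dvalV (x : K) : x != 0 -> v x^-1 = - v x.
Proof.
move=> x0; apply/eqP.
by rewrite -addr_eq0 -(dvalM vP) ?invr_eq0 // mulVf // dval1.
Qed.

Lemma dvalX (x : K) (n : nat) : x != 0 -> v (x ^+ n) = v x *+ n.
Proof.
move=> x0; elim: n => [|n IHn]; first by rewrite expr0 dval1 mulr0n.
by rewrite exprS (dvalM vP) ?expf_neq0 // IHn mulrS.
Qed.

Lemma val_ring_im_eq0 (r : R) : (f r == 0) = (r == 0).
Proof. by rewrite -(inj_eq f_inj) rmorph0. Qed.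

Lemma val_ring_ge0 (r : R) : r != 0 -> 0 <= v (f r).
Proof.
move=> r0; have : f r \in valuation_ring v by apply/f_im; exists r.
by rewrite inE val_ring_im_eq0 (negPf r0).
Qed.

(** The inverse of [f r] in [K] has valuation [- v (f r)], so it lies in the
    valuation ring along with [f r] only if both valuations vanish. *)
Lemma val_ring_unit (r : R) : r != 0 -> (r \is a GRing.unit) = (v (f r) == 0).
Proof.
move=> r0; have fr0 : f r != 0 by rewrite val_ring_im_eq0.
apply/idP/eqP => [rU | vr].
  have rV0 : r^-1 != 0 by rewrite invr_eq0.
  apply/eqP; rewrite eq_le val_ring_ge0 // andbT.
  by rewrite -oppr_ge0 -dvalV // -rmorphV // val_ring_ge0.
have [s fs] : exists s : R, f s = (f r)^-1.
  by apply/f_im; rewrite inE dvalV // vr oppr0 lexx orbT.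
apply/unitrPr; exists s; apply: f_inj.
by rewrite rmorphM fs divff // rmorph1.
Qed.

Lemma val_ring_uniformizer :
  exists pi : R,
    [/\ pi \isn't a GRing.unit,
        pi != 0
      & forall x : R, x != 0 ->
          exists (u : R) (k : nat), u \is a GRing.unit /\ x = u * pi ^+ k].
Proof.
have [t [t0 vt]] := dval_surj vP 1.
have [pi fpi] : exists pi : R, f pi = t.
  by apply/f_im; rewrite inE vt orbT.
have pi0 : pi != 0 by rewrite -val_ring_im_eq0 fpi.
exists pi; split=> // [|x x0]; first by rewrite val_ring_unit // fpi vt.
have fx0 : f x != 0 by rewrite val_ring_im_eq0.
have tk0 k : t ^+ k != 0 by rewrite expf_neq0.
have [k vx] : exists k : nat, v (f x) = k%:Z.
  by case: (v (f x)) (val_ring_ge0 x0) => // k _; exists k.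
have vq : v (f x / t ^+ k) = 0.
  by rewrite (dvalM vP) ?invr_eq0 // dvalV // dvalX // vt vx natz subrr.
have [u fu] : exists u : R, f u = f x / t ^+ k.
  by apply/f_im; rewrite inE vq lexx orbT.
have u0 : u != 0 by rewrite -val_ring_im_eq0 fu mulf_neq0 // invr_eq0.
exists u, k; split; first by rewrite val_ring_unit // fu vq.
by apply: f_inj; rewrite rmorphM rmorphXn fu fpi divfK.
Qed.

End ValuationRing.

(** * The pi-adic valuation of the fraction field *)

Local Notation "x %:F" := (@FracField.tofrac _ x).

Lemma fraction_numden (R : idomainType) (z : {fraction R}) :
  exists n d : R, d != 0 /\ z = n%:F / d%:F.
Proof.
elim/quotW: z => x; exists (frac x).1, (frac x).2.
have d0 := denom_ratioP x; split=> //.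
apply: (canRL (mulfK _)); first by rewrite tofrac_eq0.
unlock FracField.tofrac; rewrite -[LHS]FracField.pi_mul.
apply/eqmodP; rewrite /= FracField.equivfE /FracField.mulf.
by rewrite !numden_Ratio ?mulf_neq0 ?oner_neq0 // !mulr1 mulrC.
Qed.

Lemma lez_exists_nat (m n : int) : m <= n -> exists k : nat, n = m + k%:Z.
Proof.
move=> le_mn; exists `|n - m|%N.
by rewrite gez0_abs ?subr_ge0 // [RHS]addrC subrK.
Qed.

(** The relation that becomes the graph of the pi-adic valuation once existence
    and uniqueness of [n] are known. *)
Definition has_order {R : idomainType} (pi : R) (z : {fraction R}) (n : int) :=
  exists2 u : R, u \is a GRing.unit & z = u%:F * pi%:F ^ n.

Section PiAdicOrder.

Variables (R : idomainType) (pi : R).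
Hypothesis pi_nonunit : pi \isn't a GRing.unit.
Hypothesis pi_neq0 : pi != 0.
Hypothesis pi_gen : forall x : R, x != 0 ->
  exists (u : R) (k : nat), u \is a GRing.unit /\ x = u * pi ^+ k.

Let piF_neq0 : pi%:F != 0 :> {fraction R}.
Proof. by rewrite tofrac_eq0. Qed.

Lemma has_order_tofrac (x : R) :
  x != 0 -> exists k : nat, has_order pi x%:F k%:Z.
Proof.
move=> /pi_gen [u [k [uU ->]]]; exists k, u => //.
by rewrite tofracM tofracXn.
Qed.

Lemma has_orderM (y z : {fraction R}) (m n : int) :
  has_order pi y m -> has_order pi z n -> has_order pi (y * z) (m + n).
Proof.
move=> [u uU ->] [w wU ->]; exists (u * w); first by rewrite unitrM uU.
by rewrite tofracM expfzDr // mulrACA.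
Qed.

Lemma has_orderV (z : {fraction R}) (n : int) :
  has_order pi z n -> has_order pi z^-1 (- n).
Proof.
move=> [u uU ->]; exists u^-1; first by rewrite unitrV.
by rewrite invfM invr_expz rmorphV.
Qed.

Lemma has_order_exists (z : {fraction R}) :
  z != 0 -> exists n : int, has_order pi z n.
Proof.
have [a [b [b0 ->]]] := fraction_numden z.
rewrite mulf_eq0 negb_or tofrac_eq0 => /andP[a0 _].
have [k ka] := has_order_tofrac a0; have [l lb] := has_order_tofrac b0.
by exists (k%:Z - l%:Z); apply: has_orderM => //; apply: has_orderV.
Qed.

Lemma unit_mul_pi_exp (u : R) (k : nat) :
  u * pi ^+ k \is a GRing.unit -> k = 0%N.
Proof.
case: k => // k; rewrite unitrM => /andP[_].
by rewrite unitrX_pos // (negPf pi_nonunit).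
Qed.

(** Two expressions of one element with different exponents would make a unit
    of [R] equal to a unit times a positive power of [pi]. *)
Lemma has_order_uniq (z : {fraction R}) (m n : int) :
  has_order pi z m -> has_order pi z n -> m = n.
Proof.
wlog le_mn : m n / m <= n => [wlog_le | zm zn].
  by case/orP: (le_total m n) => le zm zn; [|symmetry]; apply: wlog_le.
case: zm zn => [u uU ->] [w wU eq_uw].
have [k def_n] := lez_exists_nat le_mn.
have eq_u : u = w * pi ^+ k.
  apply/eqP; rewrite -tofrac_eq tofracM tofracXn; apply/eqP.
  apply: (mulIf (expfz_neq0 m piF_neq0)).
  by rewrite eq_uw def_n expfzDr // mulrAC mulrA.
rewrite eq_u in uU.
by rewrite def_n (unit_mul_pi_exp uU) addr0.
Qed.

(** If [y] has the lower order [m], then [y + z = r * pi ^ m] with [r] in [R],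
    so the order of [y + z] is [m] plus the order of [r], a natural number. *)
Lemma has_order_add (y z : {fraction R}) (m n p : int) :
    y + z != 0 -> has_order pi y m -> has_order pi z n ->
  has_order pi (y + z) p -> Num.min m n <= p.
Proof.
wlog le_mn : y z m n / m <= n => [wlog_le | yz0 ym zn yzp].
  case/orP: (le_total m n) => le yz0 ym zn yzp; first exact: (wlog_le y z).
  by rewrite minC; apply: (wlog_le z y) => //; rewrite addrC.
rewrite (min_idPl le_mn).
case: ym zn => [u uU def_y] [w wU def_z].
have [k def_n] := lez_exists_nat le_mn.
have def_yz : y + z = (u + w * pi ^+ k)%:F * pi%:F ^ m.
  rewrite def_y def_z def_n expfzDr // tofracD tofracM tofracXn mulrDl.
  by congr (_ + _); rewrite mulrAC mulrA.
have r0 : u + w * pi ^+ k != 0.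
  by apply: contraNneq yz0 => r0; rewrite def_yz r0 tofrac0 mul0r.
have [l rl] := has_order_tofrac r0.
have pi_m : has_order pi (pi%:F ^ m) m.
  by exists 1; rewrite ?unitr1 // tofrac1 mul1r.
have := has_orderM rl pi_m; rewrite -def_yz => /(has_order_uniq yzp) ->.
by rewrite lerDr.
Qed.

Lemma has_order_integral (z : {fraction R}) (n : int) :
  z != 0 -> has_order pi z n -> 0 <= n <-> exists r : R, r%:F = z.
Proof.
move=> z0 zn; split=> [|[r def_z]].
  case: zn => u uU ->; case: n => // k _.
  by exists (u * pi ^+ k); rewrite tofracM tofracXn.
have r0 : r != 0 by rewrite -tofrac_eq0 def_z.
have [k rk] := has_order_tofrac r0; rewrite def_z in rk.
by rewrite (has_order_uniq zn rk).
Qed.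

(** The exponent is chosen together with the unit: being a pair (unit, exponent)
    that represents [z] is decidable, so the choice operator of [R * int]
    applies, whereas [has_order pi z n] alone is not a boolean condition. *)
Lemma order_function :
  exists v : {fraction R} -> int, forall z, z != 0 -> has_order pi z (v z).
Proof.
pose repr z (q : R * int) :=
  (z != 0) ==> (q.1 \is a GRing.unit) && (z == q.1%:F * pi%:F ^ q.2).
have ex_repr z : exists q, repr z q.
  have [-> | z0] := eqVneq z 0; first by exists (0, 0); rewrite /repr eqxx.
  have [n [u uU def_z]] := has_order_exists z0.
  by exists (u, n); rewrite /repr /= uU def_z eqxx implybT.
exists (fun z => (xchoose (ex_repr z)).2) => z z0.
have /implyP/(_ z0)/andP[uU /eqP def_z] := xchooseP (ex_repr z).
by exists (xchoose (ex_repr z)).1.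
Qed.

Lemma uniformizer_is_DVR : is_DVR R.
Proof.
have [v vP] := order_function.
exists {fraction R}, v, (@FracField.tofrac R); split.
- split=> [x y x0 y0 | n | x y x0 y0 xy0].
  + have xy0 : x * y != 0 by rewrite mulf_neq0.
    exact: has_order_uniq (vP _ xy0) (has_orderM (vP _ x0) (vP _ y0)).
  + have pin0 : pi%:F ^ n != 0 :> {fraction R} by rewrite expfz_neq0.
    exists (pi%:F ^ n); split=> //; apply: (has_order_uniq (vP _ pin0)).
    by exists 1; rewrite ?unitr1 // tofrac1 mul1r.
  + exact: has_order_add xy0 (vP _ x0) (vP _ y0) (vP _ xy0).
- by move=> x y /eqP; rewrite tofrac_eq => /eqP.
move=> x; rewrite inE; have [-> | x0] /= := eqVneq x 0.
  by split=> // _; exists 0; rewrite tofrac0.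
exact: has_order_integral (vP _ x0).
Qed.

End PiAdicOrder.

Theorem corollary10 (R : idomainType) :
  is_DVR R <->
  exists pi : R,
    [/\ pi \isn't a GRing.unit,
        pi != 0
      & forall x : R, x != 0 ->
          exists (u : R) (k : nat), u \is a GRing.unit /\ x = u * pi ^+ k].
Proof.
split=> [[K [v [f [vP f_inj f_im]]]] | [pi [pi_nonunit pi0 pi_gen]]].
  exact: val_ring_uniformizer vP f_inj f_im.
exact: uniformizer_is_DVR pi_nonunit pi0 pi_gen.
Qed.
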